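(* For every constant $c>0$ there is a constant $C>0$ (depending only on $c$) such that the following holds for all integers $n\ge 1$ and $k\ge 1$. Let $\mathcal{P}$ be a $k$-round public-coin randomized communication protocol for $\textsc{ghd}_{c,n}$ that errs with probability at most $\frac13$ on every input, and in which each message is $s$ bits long. Then \[ s \;\ge\; \frac{n}{2^{C k^2}} . \] In particular, for any constant number of rounds $k$, some message must have length $\Omega(n)$.
   Context: For $x,y\in\{0,1\}^n$, $\Delta(x,y)$ denotes the Hamming distance, i.e. the number of coordinates $i\in\{1,\dots,n\}$ with $x_i\ne y_i$. For $n\in\mathbb{N}$ and $c\in\mathbb{R}^+$, the Gap-Hamming-Distance partial function is \[ \textsc{ghd}_{c,n}(x,y)=\begin{cases}1 & \text{if } \Delta(x,y)\ge n/2+c\sqrt n,\\ 0 & \text{if } \Delta(x,y)\le n/2-c\sqrt n,\\ \star & \text{otherwise.}\end{cases} \] In the communication problem $\textsc{ghd}_{c,n}$, Alice holds $x\in\{0,1\}^n$, Bob holds $y\in\{0,1\}^n$, and they must agree on an output bit; the output $\star$ is matched by both $0$ and $1$, so only inputs with $\textsc{ghd}_{c,n}(x,y)\in\{0,1\}$ impose a requirement. A randomized protocol uses a public random string $r$ and has error $\varepsilon$ if for every input $(x,y)$, $\Pr_r[\text{output}\ne \textsc{ghd}_{c,n}(x,y)]\le\varepsilon$. A $k$-round protocol consists of exactly $k$ messages, with Alice and Bob alternating (Alice sending first), after which the recipient of the last message announces the output.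
   Formalization: The case of empty messages (s = 0) with GHD undefined (star) on every input is excluded, since there the claimed inequality fails (e.g. n = 1, c = 1, where a protocol sending nothing never errs). *)

(* Defs.v *)
From HB Require Import structures.
From mathcomp Require Import all_boot all_order all_algebra.
From mathcomp Require Import all_classical all_reals all_analysis.

Set Implicit Arguments.
Unset Strict Implicit.
Unset Printing Implicit Defensive.
Import Order.TTheory GRing.Theory Num.Theory.
Local Open Scope classical_set_scope.
Local Open Scope ring_scope.

Definition bits (n : nat) := n.-tuple bool.

Definition hamming (n : nat) (x y : bits n) : nat :=
  #|[pred i : 'I_n | tnth x i != tnth y i]|.

(* None stands for the value "star". For c > 0 and n >= 1 the two defined
   cases are mutually exclusive, so the order of the tests is irrelevant. *)
Definition ghd (R : realType) (c : R) (n : nat) (x y : bits n) : option bool :=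
  if n%:R / 2 + c * Num.sqrt n%:R <= (hamming x y)%:R then Some true
  else if (hamming x y)%:R <= n%:R / 2 - c * Num.sqrt n%:R then Some false
  else None.

Definition matches (b : bool) (v : option bool) : bool :=
  if v is Some b' then b == b' else true.

(* What the players do once the public random string is fixed. [next_msg i z h]
   is message number i (counted from 0) of a sender with input z, given the list
   h of the previous messages, in chronological order. Since i is an argument,
   Alice's and Bob's message functions are unrelated. [announce z h] is the
   output bit of the recipient of the last message, given its input z and the
   complete transcript h. *)
Record det_protocol (n s : nat) := DetProtocol {
  next_msg : nat -> bits n -> seq (bits s) -> bits s ;
  announce : bits n -> seq (bits s) -> bool }.

(* The input of the sender of message i: Alice for even i, Bob for odd i. *)
Definition speaker_input (n : nat) (x y : bits n) (i : nat) : bits n :=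
  if odd i then y else x.

Fixpoint transcript (n s : nat) (D : det_protocol n s) (x y : bits n)
    (k : nat) : seq (bits s) :=
  if k is i.+1 then
    let h := transcript D x y i in
    rcons h (next_msg D i (speaker_input x y i) h)
  else [::].

(* The recipient of the last message, number k - 1, is the player who would
   send message number k. *)
Definition output (n k s : nat) (D : det_protocol n s) (x y : bits n) : bool :=
  announce D (speaker_input x y k) (transcript D x y k).

(* The public random string is a point of an arbitrary probability space. *)
Record protocol (d : measure_display) (T : measurableType d) (n k s : nat) :=
  Protocol {
    run_with : T -> det_protocol n s ;
    measurable_output : forall x y : bits n,
      measurable [set r | output k (run_with r) x y] }.

Definition ghd_error_le (R : realType) (d : measure_display)
    (T : measurableType d) (mu : probability T R) (n k s : nat)
    (P : protocol T n k s) (c eps : R) : Prop :=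
  forall x y : bits n,
    (mu [set r | ~~ matches (output k (run_with P r) x y) (ghd c x y)]
       <= eps%:E)%E.

(* Main.v *)
(** Round elimination on uniform inputs. By repetition (coins chosen greedily)
one gets a deterministic protocol [f] whose average error [E] on uniform
inputs is at most [(8/9)^j]. A message of few bits is constant on a large set
of inputs of its sender that are still good on average, and by Sauer-Shelah
this set shatters an eighth [S'] of the current coordinates [S]. The sender
may then extend any [z] on [S'] to such an input, and the receiver fills in
the other coordinates with a fixed [u], which removes the message. The
coordinates outside [S'] perturb the inner product by a term that depends on
the sender's input alone, so after any number of rounds the original inner
product is [inner S x y + P x + Q y]; the potential [kappa * avg E + avg P^2 +
avg Q^2] at most doubles, up to an additive [#|S|], when [u] is chosen by
averaging. Conditioned on [inner S x y >= a] both [x] and [y] are uniform, so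
[P] and [Q] are small compared to [a] by Chebyshev; hence a protocol without
messages, which cannot distinguish [y] from its complement, errs on half of
the inputs with a large inner product. *)

Require Import Defs.
From mathcomp Require Import all_boot all_order all_algebra.
From mathcomp Require Import zify ring lra.

Set Implicit Arguments.
Unset Strict Implicit.
Unset Printing Implicit Defensive.
Import Order.TTheory GRing.Theory Num.Theory.
Local Open Scope ring_scope.

(** * Shattering and the Sauer-Shelah lemma *)

Section SauerShelah.
Variable I : finType.
Implicit Types (A : {set {set I}}) (S J B a : {set I}).

Definition shatters A S :=
  [forall B : {set I}, (B \subset S) ==> [exists a in A, a :&: S == B]].

Lemma shattersP A S :
  reflect (forall B, B \subset S -> exists2 a, a \in A & a :&: S = B)
          (shatters A S).
Proof.
apply: (iffP forallP) => [h B BS|h B].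
  by have /implyP/(_ BS)/existsP[a /andP[aA /eqP aB]] := h B; exists a.
apply/implyP => BS; have [a aA aB] := h B BS.
by apply/existsP; exists a; rewrite aA aB eqxx.
Qed.

Lemma shattersS A S S' : S' \subset S -> shatters A S -> shatters A S'.
Proof.
move=> sS /shattersP h; apply/shattersP => B BS'.
have [a aA aB] := h B (subset_trans BS' sS); exists a => //.
by rewrite -(setIidPr sS) setIA aB; apply/setIidPl.
Qed.

(** Pajor's form of the lemma, by induction on [J]: a point [j] splits [A] into the sets that avoid
    [j] and the sets that contain it, the latter recorded with [j] removed. *)
Lemma card_shattered A J : (forall a, a \in A -> a \subset J) ->
  (#|A| <= #|[set S in powerset J | shatters A S]|)%N.
Proof.
have [n] := ubnP #|J|; elim: n A J => // n IHn A J.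
have [->|[j jJ] Jn AJ] := set_0Vmem J.
  move=> _ A0; have [->|[a aA]] := set_0Vmem A; first by rewrite cards0.
  have sA : A \subset [set set0].
    by apply/subsetP => b /A0; rewrite subset0 inE.
  apply: leq_trans (subset_leq_card sA) _; rewrite cards1 card_gt0.
  apply/set0Pn; exists set0; rewrite !inE sub0set /=.
  apply/shattersP => B; rewrite subset0 => /eqP->.
  by exists a; rewrite ?setI0.
pose J' := J :\ j.
have J'n : (#|J'| < n)%N by move: Jn; rewrite (cardsD1 j) jJ.
pose A0 := [set a in A | j \notin a].
pose A1 := [set a : {set I} | (j \notin a) && (j |: a \in A)].
have A0J a : a \in A0 -> a \subset J'.
  rewrite inE => /andP[aA ja]; apply/subsetP => i ia.
  rewrite !inE (subsetP (AJ _ aA)) // andbT; apply: contraNneq ja => <- //.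
have A1J a : a \in A1 -> a \subset J'.
  rewrite inE => /andP[ja aA]; apply/subsetP => i ia.
  rewrite !inE (subsetP (AJ _ aA)) ?inE ?ia ?orbT // andbT.
  by apply: contraNneq ja => <- //.
have cA : (#|A| <= #|A0| + #|A1|)%N.
  rewrite -(cardsID [set a : {set I} | j \notin a] A) leq_add //.
    by rewrite subset_leq_card //; apply/subsetP => a; rewrite !inE.
  rewrite -(card_in_imset (f := fun a : {set I} => a :\ j)); last first.
    move=> a b; rewrite !inE !negbK => /andP[ja _] /andP[jb _] /= e.
    by rewrite -(setD1K ja) e setD1K.
  apply/subset_leq_card/subsetP => _ /imsetP[a + ->].
  by rewrite !inE negbK eqxx /= => /andP[ja aA]; rewrite setD1K.
apply: leq_trans cA _.
apply: leq_trans (leq_add (IHn _ _ J'n A0J) (IHn _ _ J'n A1J)) _.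
set F0 := [set S in _ | _]; set F1 := [set S in _ | _].
(* A set shattered by [A0] or by [A1] is shattered by [A]; a set shattered by both remains shattered
   by [A] once [j] is added. *)
rewrite -cardsUI -(cardsID [set S : {set I} | j \in S] [set _ in _ | _]) addnC.
have jF S : S \in F0 :|: F1 -> S \subset J'.
  by rewrite !inE -!andb_orr => /andP[].
rewrite leq_add //.
  rewrite -(card_in_imset (f := fun S : {set I} => j |: S)); last first.
    have jn S : S \in F0 :&: F1 -> j \notin S.
      rewrite !inE => /andP[/andP[/subsetP SJ _] _].
      by apply/negP => /SJ; rewrite !inE eqxx.
    by move=> S T /jn jS /jn jT /= e; rewrite -(setU1K jS) e setU1K.
  apply/subset_leq_card/subsetP => _ /imsetP[S + ->].
  rewrite !inE eqxx andbT.
  move=> /andP[/andP[SJ /shattersP h0] /andP[_ /shattersP h1]].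
  rewrite subUset sub1set jJ (subset_trans SJ (subsetDl _ _)) /=.
  have jS : j \notin S by apply/negP => /(subsetP SJ); rewrite !inE eqxx.
  apply/shattersP => B BS.
  have BSj : B :\ j \subset S by rewrite subDset.
  have [jB|jB] := boolP (j \in B).
    have [a + aS] := h1 _ BSj; rewrite inE => /andP[ja aA].
    by exists (j |: a); rewrite // -setUIr aS setD1K.
  have [a + aS] := h0 _ BSj; rewrite inE => /andP[aA ja].
  exists a => //; apply/setP => i; have /setP/(_ i) := aS.
  by rewrite !inE; case: eqVneq => [->|//]; rewrite (negbTE ja) (negbTE jB).
apply/subset_leq_card/subsetP => S SF; have SJ := jF _ SF.
have jS : j \notin S by apply/negP => /(subsetP SJ); rewrite !inE eqxx.
rewrite !inE jS (subset_trans SJ (subsetDl _ _)) /=; apply/shattersP => B BS.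
move: SF; rewrite !inE => /orP[]/andP[_ /shattersP/(_ B BS)[a]];
  rewrite inE => /andP[].
  by move=> aA _ aB; exists a.
move=> ja aA aB; exists (j |: a) => //; rewrite -aB.
apply/setP => i; rewrite !inE; case: eqVneq => [->|//].
by rewrite (negbTE ja) (negbTE jS).
Qed.

Lemma sum_powerset_exp S :
  (\sum_(U in powerset S) 2 ^ (#|S| - #|U|) = 3 ^ #|S|)%N.
Proof.
rewrite -[3%N]/(2 + 1)%N expnDn.
rewrite (partition_big (fun U : {set I} => inord #|U| : 'I_#|S|.+1) xpredT) //=.
apply: eq_bigr => i _; rewrite exp1n muln1.
have -> : 'C(#|S|, i) =
    (\sum_(U in [set U : {set I} | U \subset S & #|U| == i]) 1)%N.
  by rewrite sum1_card cards_draws.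
rewrite big_distrl /=.
have cU (U : {set I}) : U \subset S -> (inord #|U| : 'I_#|S|.+1) = #|U| :> nat.
  by move=> /subset_leq_card US; rewrite inordK.
apply: eq_big => U.
  rewrite !inE; have [US|//] := boolP (U \subset S).
  by rewrite -val_eqE /= cU.
by rewrite inE => /andP[US /eqP<-]; rewrite mul1n cU.
Qed.

(** If every shattered set had fewer than [d] points, each of them, and there are at least [#|A|],
    would contribute at least [2 ^ (#|S| - d)] to a sum whose total is [3 ^ #|S|]. *)
Lemma exists_shattered A S d : (forall a, a \in A -> a \subset S) ->
  (3 ^ #|S| < #|A| * 2 ^ (#|S| - d))%N ->
  exists S', [/\ S' \subset S, #|S'| = d & shatters A S'].
Proof.
move=> AS lt; have [/existsP[U /andP[dU]]|/existsPn noU] :=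
    boolP [exists U : {set I}, (d <= #|U|)%N &&
            (U \in [set U in powerset S | shatters A U])].
  rewrite !inE => /andP[US AU].
  have : (0 < #|[set V : {set I} | V \subset U & #|V| == d]|)%N.
    by rewrite cards_draws bin_gt0.
  move=> /card_gt0P[V]; rewrite inE => /andP[VU /eqP Vd].
  by exists V; split=> //; [exact: subset_trans VU US|exact: shattersS AU].
have /leq_trans : (#|A| * 2 ^ (#|S| - d) <= 3 ^ #|S|)%N; last first.
  by move=> /(_ _ (leqnn _)); rewrite leqNgt lt.
rewrite -sum_powerset_exp.
apply: leq_trans (leq_mul (card_shattered AS) (leqnn _)) _.
rewrite -sum_nat_const.
rewrite [leqRHS](bigID (shatters A)) /= -[leqLHS]addn0 leq_add //.
rewrite (eq_bigl (fun U => (U \in powerset S) && shatters A U)); last first.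
  by move=> U; rewrite inE.
apply: leq_sum => U /andP[US AU]; rewrite leq_exp2l // leq_sub2l //.
by have := noU U; rewrite negb_and inE US AU orbF -ltnNge => /ltnW.
Qed.

End SauerShelah.

(** * Averages over the subsets of a finite set *)

Section Average.
Variables (R : realFieldType) (I : finType).
Implicit Types (S T U x y : {set I}) (f g : {set I} -> R).

Definition average S f : R := (\sum_(x in powerset S) f x) / 2 ^+ #|S|.

Lemma exp2_gt0 n : 0 < 2 ^+ n :> R.
Proof. by rewrite exprn_gt0. Qed.

Lemma eq_average S f g : (forall x, x \subset S -> f x = g x) ->
  average S f = average S g.
Proof.
by move=> fg; congr (_ / _); apply: eq_bigr => x; rewrite inE; apply: fg.
Qed.

Lemma ler_average S f g : (forall x, x \subset S -> f x <= g x) ->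
  average S f <= average S g.
Proof.
move=> fg; rewrite ler_pM2r ?invr_gt0 ?exp2_gt0 //.
by apply: ler_sum => x; rewrite inE; apply: fg.
Qed.

Lemma average_cst S (c : R) : average S (fun=> c) = c.
Proof.
rewrite /average sumr_const card_powerset -[c *+ _]mulr_natr natrX mulfK //.
by rewrite gt_eqF ?exp2_gt0.
Qed.

Lemma averageD S f g :
  average S (fun x => f x + g x) = average S f + average S g.
Proof. by rewrite /average big_split mulrDl. Qed.

Lemma averageZ S (c : R) f : average S (fun x => c * f x) = c * average S f.
Proof. by rewrite /average -mulr_sumr mulrA. Qed.

Lemma average_ge0 S f : (forall x, x \subset S -> 0 <= f x) ->
  0 <= average S f.
Proof. by move=> f0; rewrite -(average_cst S 0); apply: ler_average. Qed.

Lemma exchange_average S T (f : {set I} -> {set I} -> R) :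
  average S (fun x => average T (fun y => f x y)) =
  average T (fun y => average S (fun x => f x y)).
Proof.
rewrite /average -!mulr_suml exchange_big /= -!mulrA; congr (_ * _).
exact: mulrC.
Qed.

(** Coordinates inside and outside [T] are independent under the uniform measure: [x] is recovered
    from its two traces. *)
Lemma average_split S T f : T \subset S ->
  average S f =
  average T (fun w => average (S :\: T) (fun u => f (w :|: u))).
Proof.
move=> TS; rewrite /average -mulr_suml -mulrA -invfM -exprD.
have -> : (#|S :\: T| + #|T| = #|S|)%N.
  by rewrite addnC -(cardsID T S) (setIidPr TS).
congr (_ / _).
rewrite (partition_big (fun x => x :&: T) (mem (powerset T))) /=; last first.
  by move=> x _; rewrite inE subsetIr.
apply: eq_bigr => w; rewrite inE => wT.
rewrite (reindex_onto (fun u => w :|: u) (fun x => x :\: T)) /=; last first.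
  by move=> x /andP[_ /eqP <-]; rewrite setID.
apply: eq_bigl => u; rewrite !inE subUset (subset_trans wT TS) /=.
apply/andP/idP => [[/andP[uS _] /eqP <-]|uST].
  by rewrite setDUl (eqP (_ : w :\: T == set0)) ?setD_eq0 // set0U setSD.
have [uS uT] : u \subset S /\ [disjoint u & T] by apply/andP; rewrite -subsetD.
split; first rewrite uS /= setIUl (setIidPl wT).
  by rewrite (eqP (_ : u :&: T == set0)) ?setU0 // setI_eq0.
rewrite setDUl (eqP (_ : w :\: T == set0)) ?setD_eq0 // set0U.
by apply/eqP/setDidPl.
Qed.

Lemma exists_le_average S f :
  exists2 x : {set I}, x \subset S & f x <= average S f.
Proof.
have [/existsP[x /andP[xS fx]]|/existsPn no] :=
  boolP [exists x : {set I}, (x \subset S) && (f x <= average S f)].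
  by exists x.
have : average S f < average S f; last by rewrite ltxx.
rewrite -{1}(average_cst S (average S f)) ltr_pM2r ?invr_gt0 ?exp2_gt0 //.
apply: ltr_sum => [|x].
  by apply/hasP; exists set0; rewrite ?mem_index_enum // inE sub0set.
by rewrite inE => xS; have := no x; rewrite xS /= -ltNge.
Qed.

Lemma average_compl S f : average S (fun y => f (S :\: y)) = average S f.
Proof.
congr (_ / _); rewrite [RHS](reindex_onto (setD S) (setD S)) /=; last first.
  by move=> y; rewrite inE => yS; rewrite setDDr setDv set0U; apply/setIidPr.
apply: eq_bigl => y; rewrite !inE subsetDl /=.
by rewrite setDDr setDv set0U; apply/idP/eqP => /setIidPr.
Qed.

Lemma markov_half S f : (forall x, x \subset S -> 0 <= f x) ->
  (2 ^ #|S| <= 2 * #|[set x in powerset S | (f x <= 2 * average S f)%R]|)%N.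
Proof.
move=> f0; set T := [set _ in _ | _].
have : (#|powerset S :\: T| * 2 <= 2 ^ #|S|)%N; last first.
  rewrite -card_powerset -[#|powerset S|](cardsID T).
  rewrite (setIidPr _) ?subsetIl //; first by lia.
  by apply/subsetP => x; rewrite !inE => /andP[].
have av0 := average_ge0 f0.
have fle : \sum_(x in powerset S :\: T) (2 * average S f) <=
    \sum_(x in powerset S) f x.
  rewrite [leRHS](big_setID T) /= ler_wpDl ?sumr_ge0 //.
    by move=> x; rewrite !inE => /andP[xS _]; apply: f0.
  apply: ler_sum => x; rewrite !inE => /andP[+ xS]; rewrite xS /= -ltNge.
  exact: ltW.
move: fle; rewrite -[\sum_(x in powerset S) f x](@divfK _ (2 ^+ #|S|)) ?gt_eqF ?exp2_gt0 //.
rewrite -/(average S f) sumr_const -[_ *+ #|_|]mulr_natr.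
have [av_gt0|] := ltP 0 (average S f).
  by rewrite mulrC mulrA [leRHS]mulrC ler_pM2r // -natrX -natrM ler_nat.
(* Dividing by the mean is impossible when it vanishes; but then [f] vanishes on every subset of [S]
   and no point is exceptional. *)
move=> avle; have {avle av0}av00 : average S f = 0 by apply/le_anti/andP.
move=> _; suff -> : powerset S :\: T = set0 by rewrite cards0.
apply/eqP; rewrite setD_eq0; apply/subsetP => x xS; rewrite inE xS /=.
have : \sum_(x in powerset S) f x == 0.
  by move/eqP: av00; rewrite mulf_eq0 invr_eq0 (gt_eqF (exp2_gt0 _)) orbF.
rewrite psumr_eq0 => [/allP/(_ x)|y]; last by rewrite inE; apply: f0.
by rewrite mem_index_enum xS av00 mulr0 => /(_ isT) /eqP->.
Qed.

End Average.

(** * Moments and tails of sums of independent signs *)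

Section SignSums.
Variables (R : realFieldType).
Implicit Types (f g : R -> R).

(* The expectation of [f] at the sum of [n] independent uniform signs. *)
Fixpoint sign_mean n f : R :=
  if n is n'.+1 then
    (sign_mean n' (fun v => f (v + 1)) + sign_mean n' (fun v => f (v - 1))) / 2
  else f 0.

Lemma eq_sign_mean n f g : f =1 g -> sign_mean n f = sign_mean n g.
Proof.
elim: n f g => [|n IHn] f g fg /=; first exact: fg.
by congr ((_ + _) / _); apply: IHn => v; apply: fg.
Qed.

Lemma ler_sign_mean n f g : (forall v, f v <= g v) ->
  sign_mean n f <= sign_mean n g.
Proof.
elim: n f g => [|n IHn] f g fg /=; first exact: fg.
by rewrite ler_pM2r ?invr_gt0 // lerD // IHn.
Qed.

Lemma sign_mean_cst n (c : R) : sign_mean n (fun=> c) = c.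
Proof. by elim: n => //= n ->; field. Qed.

Lemma sign_mean_linear n (a b : R) f g :
  sign_mean n (fun v => a * f v + b * g v) =
  a * sign_mean n f + b * sign_mean n g.
Proof. by elim: n f g => //= n IHn f g; rewrite !IHn; field. Qed.

Lemma sign_mean_opp n f : sign_mean n (fun v => f (- v)) = sign_mean n f.
Proof.
elim: n f => [|n IHn] f /=; first by rewrite oppr0.
rewrite addrC; congr ((_ + _) / _).
  by rewrite -[RHS]IHn; apply: eq_sign_mean => v; rewrite opprD opprK.
by rewrite -[RHS]IHn; apply: eq_sign_mean => v; rewrite opprD.
Qed.

Lemma sign_meanD n m f :
  sign_mean (n + m) f = sign_mean n (fun u => sign_mean m (fun v => f (u + v))).
Proof.
elim: n f => [|n IHn] f /=.
  by apply: eq_sign_mean => v; rewrite add0r.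
by rewrite !IHn; congr ((_ + _) / _); apply: eq_sign_mean => u;
  apply: eq_sign_mean => v; congr f; ring.
Qed.

(** The odd coefficients are carried along because the induction shifts the argument by one sign,
    which mixes all coefficients. *)
Lemma sign_mean_poly4 n (a0 a1 a2 a3 a4 : R) :
  sign_mean n (fun v => a0 + a1 * v + a2 * v ^+ 2 + a3 * v ^+ 3 + a4 * v ^+ 4)
  = a0 + a2 * n%:R + a4 * (3 * n%:R ^+ 2 - 2 * n%:R).
Proof.
elim: n a0 a1 a2 a3 a4 => [|n IHn] a0 a1 a2 a3 a4 /=; first by ring.
(* The polynomial at [v + e], simplified by [e ^+ 2 = 1]. *)
pose s (e : R) := fun v : R => (a0 + a1 * e + a2 + a3 * e + a4)
  + (a1 + 2 * a2 * e + 3 * a3 + 4 * a4 * e) * v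
  + (a2 + 3 * a3 * e + 6 * a4) * v ^+ 2 + (a3 + 4 * a4 * e) * v ^+ 3
  + a4 * v ^+ 4.
rewrite (@eq_sign_mean n _ (s 1)); last by move=> v; rewrite /s; ring.
rewrite (@eq_sign_mean n (fun v => _ + _ * (v - 1) + _ + _ + _) (s (-1)));
  last by move=> v; rewrite /s; ring.
by rewrite !IHn -natr1; field.
Qed.

Lemma sign_mean_sqr n (c : R) :
  sign_mean n (fun v => (c + v) ^+ 2) = c ^+ 2 + n%:R.
Proof.
rewrite (@eq_sign_mean n _ (fun v =>
  c ^+ 2 + 2 * c * v + 1 * v ^+ 2 + 0 * v ^+ 3 + 0 * v ^+ 4)); last first.
  by move=> v; ring.
by rewrite sign_mean_poly4; ring.
Qed.

Definition sign_tail n (a : R) := sign_mean n (fun v => (a <= v)%R%:R).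

(* Paley-Zygmund from the second and fourth moments. *)
Lemma sign_tail_sqrt n (a : R) : (0 < n)%N -> 0 <= a ->
  4 * a ^+ 2 <= n%:R -> 1 / 16 <= sign_tail n a.
Proof.
move=> n0 a0 an; have n0R : 0 < n%:R :> R by rewrite ltr0n.
pose g v : R := 1 * (a <= v)%R%:R + 1 * (a <= - v)%R%:R.
have gE : sign_mean n g = 2 * sign_tail n a.
  rewrite sign_mean_linear (sign_mean_opp n (fun v => (a <= v)%R%:R)).
  by rewrite /sign_tail; ring.
(* The polynomial is at most [2n] everywhere and at most [0] where [|v| < a], since
   [a ^+ 2 <= n / 4]. Its mean is [3n/8 + 1/4], to be compared with [4n] times the tail. *)
have : sign_mean n (fun v => - (n%:R / 4) + 0 * v + 1 * v ^+ 2 + 0 * v ^+ 3 +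
    (- (8 * n%:R)^-1) * v ^+ 4) <=
    sign_mean n (fun v => 2 * n%:R * g v + 0 * g v).
  apply: ler_sign_mean => v.
  have h : v ^+ 2 - (8 * n%:R)^-1 * v ^+ 4 <= 2 * n%:R.
    have -> : v ^+ 2 - (8 * n%:R)^-1 * v ^+ 4 =
        2 * n%:R - (8 * n%:R)^-1 * (v ^+ 2 - 4 * n%:R) ^+ 2.
      by field; rewrite gt_eqF.
    by rewrite gerBl mulr_ge0 ?sqr_ge0 // invr_ge0 ltW // mulr_gt0.
  have h4 : 0 <= (8 * n%:R)^-1 * v ^+ 4.
    by rewrite mulr_ge0 ?invr_ge0 ?exprn_even_ge0 // mulr_ge0 // ltW.
  rewrite /g; have [av|va] := leP a v => /=.
    by have [_|_] := leP a (- v) => /=; nra.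
  have [av|va'] := leP a (- v) => /=; first by nra.
  suff : v ^+ 2 <= a ^+ 2 by nra.
  by nra.
rewrite sign_mean_poly4 sign_mean_linear gE mul0r addr0 mul1r.
have -> : (- (8 * n%:R)^-1) * (3 * n%:R ^+ 2 - 2 * n%:R) =
  - (3 / 8) * n%:R + 1 / 4 :> R by field; rewrite gt_eqF.
by move: (sign_tail n a) => p; nra.
Qed.

Lemma sign_tail_add n m (a b : R) :
  sign_tail n a * sign_tail m b <= sign_tail (n + m) (a + b).
Proof.
rewrite /sign_tail sign_meanD.
rewrite mulrC -[leLHS]addr0 -(mul0r (sign_mean n (fun v => (a <= v)%R%:R))).
rewrite -sign_mean_linear; apply: ler_sign_mean => u; rewrite mul0r addr0.
have [au|_] := leP a u; last first.
  rewrite mulr0 -(sign_mean_cst m 0); apply: ler_sign_mean => v.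
  by rewrite ler0n.
rewrite mulr1; apply: ler_sign_mean => v; rewrite ler_nat.
by have [bv|//] := leP b v; rewrite lerD.
Qed.

(** Each of [q] independent blocks is asked to reach [a]. This bounds from below the probability of
    a deviation of about [sqrt q] standard deviations. *)
Lemma sign_tail_blocks q b (a : R) : (0 < b)%N -> 0 <= a ->
  4 * a ^+ 2 <= b%:R -> (1 / 16) ^+ q <= sign_tail (q * b) (q%:R * a).
Proof.
move=> b0 a0 ab; elim: q => [|q IHq].
  by rewrite /sign_tail /= mul0r lexx expr0.
rewrite mulSn -(natr1 q) mulrDl [1 * a]mul1r [_ + a]addrC exprS.
apply: le_trans (sign_tail_add _ _ _ _); apply: ler_pM => //.
- by rewrite divr_ge0.
- by rewrite exprn_ge0 // divr_ge0.
- exact: sign_tail_sqrt.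
Qed.

End SignSums.

(** * The inner product of sign vectors *)

Section InnerProduct.
Variables (R : realFieldType) (I : finType).
Implicit Types (S T x y w u : {set I}).

(** Subsets encode sign vectors; the value counts agreements minus disagreements on [S], that is
    [#|S|] minus twice the Hamming distance. *)
Definition inner S x y : R :=
  \sum_(i in S) (-1) ^+ ((i \in x) (+) (i \in y)).

Lemma inner_sym S x y : inner S x y = inner S y x.
Proof. by apply: eq_bigr => i _; rewrite addbC. Qed.

Lemma eq_inner S x y x' y' : x :&: S = x' :&: S -> y :&: S = y' :&: S ->
  inner S x y = inner S x' y'.
Proof.
move=> /setP ex /setP ey; apply: eq_bigr => i iS.
by have := ex i; have := ey i; rewrite !inE iS !andbT => -> ->.
Qed.

Lemma inner_split S T x y : T \subset S ->
  inner S x y = inner T x y + inner (S :\: T) x y.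
Proof. by move=> TS; rewrite /inner (big_setID T) /= (setIidPr TS). Qed.

Lemma inner_compl S x y : inner S x (S :\: y) = - inner S x y.
Proof.
rewrite /inner -sumrN; apply: eq_bigr => i iS; rewrite inE iS andbT.
by case: (i \in x); case: (i \in y); rewrite /= ?expr0 ?expr1 ?opprK.
Qed.

(** Multiplying a uniform sign by a fixed sign leaves it uniform, so the law does not depend on [x].
    The induction splits off one coordinate of [S]. *)
Lemma average_inner S x (f : R -> R) :
  average S (fun y => f (inner S x y)) = sign_mean #|S| f.
Proof.
have [n nS] : {n | #|S| = n} by exists #|S|.
elim: n S nS f => [|n IHn] S nS f.
  have /eqP-> : S == set0 by rewrite -cards_eq0 nS.
  rewrite /average powerset0 big_set1 cards0 divr1 /=.
  by rewrite /inner big_set0.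
have /card_gt0P[j jS] : (0 < #|S|)%N by rewrite nS.
have jS' : [set j] \subset S by rewrite sub1set.
have cS : #|S :\: [set j]| = n.
  by have := cardsD1 j S; rewrite nS jS => -[].
rewrite (average_split _ jS') nS /=.
have split_sum w u : w \subset [set j] -> u \subset S :\: [set j] ->
  inner S x (w :|: u) =
    inner (S :\: [set j]) x u + (-1) ^+ ((j \in x) (+) (j \in w)).
  move=> wj uS; rewrite (inner_split _ _ jS') addrC; congr (_ + _).
    apply: eq_bigr => i; rewrite !inE => /andP[ij _].
    suff /negbTE-> : i \notin w by [].
    by apply: contra ij => /(subsetP wj); rewrite inE.
  rewrite /inner big_set1 inE.
  suff /negbTE-> : j \notin u by rewrite orbF.
  by apply/negP => /(subsetP uS); rewrite !inE eqxx.
have avw w : w \subset [set j] ->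
    average (S :\: [set j]) (fun u => f (inner S x (w :|: u))) =
    sign_mean n (fun v => f (v + (-1) ^+ ((j \in x) (+) (j \in w)))).
  move=> wj; rewrite -[in RHS]cS -IHn //.
  by apply: eq_average => u uS; rewrite split_sum.
rewrite (eq_average avw) /average cards1 expr1; congr (_ / _).
rewrite powerset1 big_setU1 ?big_set1 ?inE /=; last first.
  by rewrite eq_sym; apply/set0Pn; exists j; rewrite inE.
rewrite ?inE ?eqxx; case: (j \in x) => /=; rewrite ?expr0 ?expr1 //.
exact: addrC.
Qed.

End InnerProduct.

(** * Deterministic protocols as nested functions *)

Section Protocols.
Variables (Msg Out : Type).

(* [f x y] can be computed with [k] messages when the owner of [x] speaks first;
   the player who would speak next announces the output. *)
Fixpoint computable_in (k : nat) (X Y : Type) (f : X -> Y -> Out) : Prop :=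
  if k is k'.+1 then
    exists (msg : X -> Msg) (rest : Msg -> Y -> X -> Out),
      (forall m, computable_in k' (rest m)) /\
      forall x y, f x y = rest (msg x) y x
  else exists g : X -> Out, forall x y, f x y = g x.

(** Each player may transform its own input without communicating. *)
Lemma computable_in_comp k (X Y X' Y' : Type) (phi : X' -> X) (psi : Y' -> Y)
    (f : X -> Y -> Out) :
  computable_in k f -> computable_in k (fun x y => f (phi x) (psi y)).
Proof.
elim: k X Y X' Y' phi psi f => [|k IHk] X Y X' Y' phi psi f /=.
  by move=> [g fg]; exists (fun x => g (phi x)) => x y; rewrite fg.
move=> [msg [rest [hr fE]]].
exists (fun x => msg (phi x)), (fun m y x => rest m (psi y) (phi x)).
by split=> [m|x y]; [apply: IHk|rewrite fE].
Qed.

End Protocols.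

(** * Round elimination *)

Lemma leq_expr (m n e : nat) : (m <= n -> m ^ e <= n ^ e)%N.
Proof. by case: e => // e mn; rewrite leq_exp2r. Qed.
(** This is where the fraction one eighth comes from: [3 ^ 8 * 8 <= 4 ^ 8]. *)
Lemma exp3_mul_exp8_le n d : (8 * d <= n)%N -> (3 ^ n * 8 ^ d <= 4 ^ n)%N.
Proof.
move=> /subnKC <-; move: (n - 8 * d)%N => r.
rewrite [(3 ^ _)%N]expnD [(4 ^ _)%N]expnD mulnAC.
apply: leq_mul; last exact: leq_expr.
rewrite [(3 ^ _)%N]expnM [(4 ^ _)%N]expnM.
have : (3 ^ 8 * 8 <= 4 ^ 8)%N by lia.
by rewrite -expnMn; exact: leq_expr.
Qed.

Section RoundElimination.
Variables (R : realFieldType) (I : finType) (Msg : finType).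
Implicit Types (S T x y w z u : {set I}).

(* Output [true] claims that the distance is large, i.e. that the inner product
   [v] is very negative. *)
Definition wrong (tau : R) (b : bool) (v : R) : bool :=
  if b then tau <= v else v <= - tau.

(** The weight [kappa] puts error probability on the scale of a squared inner product; it will be
    [a ^+ 2 / (16 * p)] with [p] the tail probability at [a]. *)
Definition potential (kappa : R) S (E : {set I} -> {set I} -> R)
    (P Q : {set I} -> R) : R :=
  kappa * average S (fun x => average S (E x))
  + average S (fun x => P x ^+ 2) + average S (fun y => Q y ^+ 2).

Lemma zero_round_potential (a tau : R) S f (E : {set I} -> {set I} -> R) P Q :
  0 < a -> 2 * tau <= a -> 0 < sign_tail #|S| a ->
  (forall x y, 0 <= E x y) ->
  (forall x y, x \subset S -> y \subset S ->
     wrong tau (f x y) (inner R S x y + P x + Q y) -> 1 <= E x y) ->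
  computable_in Msg 0 f ->
  a ^+ 2 / 32 <= potential (a ^+ 2 / (16 * sign_tail #|S| a)) S E P Q.
Proof.
move=> a0 atau; set p := sign_tail _ _ => p0 E0 hE /= [g fg].
pose h x y : R := (a <= inner R S x y)%R%:R.
(* If some noise term is large, the left-hand side is nonpositive. Otherwise each is at most [a / 4]
   in absolute value, and the common answer on [y] and its complement is wrong on one of them. *)
have pointwise x y : x \subset S -> y \subset S ->
    h x y * (1 - 16 / a ^+ 2 *
      (P x ^+ 2 + (Q y ^+ 2 + Q (S :\: y) ^+ 2))) <=
    E x y + E x (S :\: y).
  move=> xS yS; have cS : S :\: y \subset S by rewrite subsetDl.
  have hE1 := hE x y xS yS; have hE2 := hE x _ xS cS.
  have := E0 x y; have := E0 x (S :\: y).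
  move: hE1 hE2; rewrite !fg inner_compl /h.
  have [le_a|_] := leP a (inner R S x y); last first.
    by move=> _ _ e1 e2; rewrite mul0r addr_ge0.
  rewrite mul1r; set s := _ + (_ + _).
  have [big|small] := leP (a ^+ 2 / 16) s.
    have : 1 <= 16 / a ^+ 2 * s.
      rewrite -(@ler_pM2l _ (a ^+ 2 / 16)) ?divr_gt0 ?exprn_gt0 //.
      by rewrite mulr1 mulrA (_ : _ * (16 / _) = 1) ?mul1r //; field; rewrite gt_eqF.
    by lra.
  have s0 : 0 <= 16 / a ^+ 2 * s.
    by rewrite mulr_ge0 ?divr_ge0 ?addr_ge0 ?sqr_ge0.
  have bound (v : R) : v ^+ 2 <= s -> - (a / 4) <= v <= a / 4.
    by move=> vs; apply/andP; split; nra.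
  have /andP[P1 P2] : - (a / 4) <= P x <= a / 4.
    by apply: bound; rewrite /s lerDl addr_ge0 ?sqr_ge0.
  have /andP[Q1 Q2] : - (a / 4) <= Q y <= a / 4.
    by apply: bound; rewrite /s addrCA lerDl addr_ge0 ?sqr_ge0.
  have /andP[Q3 Q4] : - (a / 4) <= Q (S :\: y) <= a / 4.
    by apply: bound; rewrite /s addrA lerDr addr_ge0 ?sqr_ge0.
  rewrite /wrong; case: (g x) => hE1 hE2.
    by have := hE1 ltac:(lra); lra.
  by have := hE2 ltac:(lra); lra.
have avE : average S (fun x => average S (fun y => E x y + E x (S :\: y))) =
    2 * average S (fun x => average S (E x)).
  rewrite -averageZ; apply: eq_average => x _.
  by rewrite averageD (average_compl S (E x)); ring.
(* Both marginals of [h] are constant, so weighting by [h] multiplies the second moments of [P] and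
   [Q] by exactly [p]. *)
have hp x : average S (h x) = p.
  exact: (average_inner S x (fun v => (a <= v)%R%:R)).
have hp' y : average S (h^~ y) = p.
  by rewrite -(hp y); apply: eq_average => x _; rewrite /h inner_sym.
have : average S (fun x => average S (fun y => h x y * (1 - 16 / a ^+ 2 *
      (P x ^+ 2 + (Q y ^+ 2 + Q (S :\: y) ^+ 2))))) <=
    2 * average S (fun x => average S (E x)).
  rewrite -avE; apply: ler_average => x xS; apply: ler_average => y yS.
  exact: pointwise.
have expand x y : h x y * (1 - 16 / a ^+ 2 *
      (P x ^+ 2 + (Q y ^+ 2 + Q (S :\: y) ^+ 2))) =
    (1 - 16 / a ^+ 2 * P x ^+ 2) * h x y +
    (- (16 / a ^+ 2) * (Q y ^+ 2 + Q (S :\: y) ^+ 2)) * h x y by ring.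
have -> : average S (fun x => average S (fun y => h x y * (1 - 16 / a ^+ 2 *
      (P x ^+ 2 + (Q y ^+ 2 + Q (S :\: y) ^+ 2))))) =
    p * (1 - 16 / a ^+ 2 * (average S (fun x => P x ^+ 2) +
          2 * average S (fun y => Q y ^+ 2))).
  under eq_average do under eq_average do rewrite expand.
  under eq_average do rewrite averageD averageZ hp.
  rewrite averageD exchange_average.
  under [X in _ + X]eq_average do rewrite averageZ hp'.
  under eq_average do rewrite mulrC mulrBr mulr1.
  rewrite averageD average_cst.
  under [X in _ + X + _]eq_average do rewrite mulrA -mulNr.
  under [X in _ + _ + X]eq_average do rewrite mulrC mulrA.
  rewrite !averageZ averageD (average_compl S (fun y => Q y ^+ 2)); ring.
rewrite /potential; move: (average S (fun x => average S _)) => e.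
have : 0 <= average S (fun x => P x ^+ 2).
  by apply: average_ge0 => x _; rewrite sqr_ge0.
move: (average S (fun x => P x ^+ 2)) => u.
move: (average S (fun y => Q y ^+ 2)) => v u0 huv.
(* Scaling by [a ^+ 2 / (2 * p)] turns the error into [16 * kappa * e]; then [a ^+ 2 / 2] is at most
   16 times the potential. *)
have : p * (a ^+ 2 / p / 2) * (1 - 16 / a ^+ 2 * (u + 2 * v)) <=
       2 * e * (a ^+ 2 / p / 2).
  by rewrite mulrAC; apply: ler_wpM2r huv; rewrite !divr_ge0 ?sqr_ge0 // ltW.
have -> : p * (a ^+ 2 / p / 2) * (1 - 16 / a ^+ 2 * (u + 2 * v)) =
    a ^+ 2 / 2 - 8 * (u + 2 * v) by field; rewrite !gt_eqF.
have -> : 2 * e * (a ^+ 2 / p / 2) = 16 * (a ^+ 2 / (16 * p) * e).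
  by field; rewrite !gt_eqF.
move: (a ^+ 2 / _ * e) => X; lra.
Qed.

Lemma pigeonhole_card (X : finType) (T : {set X}) (msg : X -> Msg) (m0 : Msg) :
  exists m, (#|T| <= #|Msg| * #|[set x in T | msg x == m]|)%N.
Proof.
have [m _ hm] := arg_maxnP
  (fun m => #|[set x in T | msg x == m]|) (erefl (xpredT m0)).
exists m; rewrite -sum1_card (partition_big msg xpredT) //=.
rewrite -sum_nat_const; apply: leq_sum => i _.
apply: leq_trans (hm i isT); rewrite -sum1_card.
by apply: eq_leq; apply: eq_bigl => x; rewrite inE.
Qed.

Lemma elimination_step (kappa tau : R) k d S f
    (E : {set I} -> {set I} -> R) P Q :
  0 <= kappa -> (8 * d <= #|S|)%N -> (2 * #|Msg| < 4 ^ d)%N ->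
  (forall x y, 0 <= E x y) ->
  (forall x y, x \subset S -> y \subset S ->
     wrong tau (f x y) (inner R S x y + P x + Q y) -> 1 <= E x y) ->
  computable_in Msg k.+1 f ->
  exists S' f' (E' : {set I} -> {set I} -> R) P' Q',
  [/\ #|S'| = d, computable_in Msg k f',
    forall x y, 0 <= E' x y,
    forall x y, x \subset S' -> y \subset S' ->
     wrong tau (f' x y) (inner R S' x y + P' x + Q' y) -> 1 <= E' x y &
    potential kappa S' E' P' Q' <= 2 * potential kappa S E P Q + #|S|%:R].
Proof.
move=> k0 dS Md E0 hE /= [msg [rest [hrest fE]]].
(* The part of the potential governed by the sender's input; restricting to inputs of cost at most
   twice the mean is what doubles the potential. *)
pose cost x := kappa * average S (E x) + P x ^+ 2.
have cost0 x : 0 <= cost x.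
  by rewrite addr_ge0 ?sqr_ge0 // mulr_ge0 // average_ge0.
pose T := [set x in powerset S | cost x <= 2 * average S cost].
have cT : (2 ^ #|S| <= 2 * #|T|)%N by apply: markov_half => x _.
have [m Tm] := pigeonhole_card T msg (msg set0).
set A := [set x in T | _] in Tm.
have AS x : x \in A -> x \subset S by rewrite !inE => /andP[/andP[]].
have Acost x : x \in A -> cost x <= 2 * average S cost.
  by rewrite !inE => /andP[/andP[]].
have Amsg x : x \in A -> msg x = m by rewrite inE => /andP[_ /eqP].
(* Markov and the pigeonhole leave more than [2 ^ #|S| / 4 ^ d] inputs, while [3 ^ #|S|] is at most
   [4 ^ #|S| / 8 ^ d]. *)
have ltA : (3 ^ #|S| < #|A| * 2 ^ (#|S| - d))%N.
  have h1 := exp3_mul_exp8_le dS.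
  have h2 : (2 ^ #|S| <= 2 * #|Msg| * #|A|)%N by lia.
  have dS' : (d <= #|S|)%N by lia.
  have eS : (2 ^ #|S| = 2 ^ (#|S| - d) * 2 ^ d)%N by rewrite -expnD subnK.
  have A0 : (0 < #|A|)%N.
    by rewrite lt0n; apply: contraTneq h2 => ->; rewrite muln0 -ltnNge expn_gt0.
  have h3 : (2 ^ #|S| < 4 ^ d * #|A|)%N.
    by apply: leq_ltn_trans h2 _; rewrite ltn_pmul2r.
  rewrite -(@ltn_pmul2r (8 ^ d)) ?expn_gt0 //.
  apply: leq_ltn_trans h1 _.
  have -> : (4 ^ #|S| = 2 ^ #|S| * (2 ^ (#|S| - d) * 2 ^ d))%N.
    by rewrite -eS -expnMn.
  have -> : (#|A| * 2 ^ (#|S| - d) * 8 ^ d =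
             4 ^ d * #|A| * (2 ^ (#|S| - d) * 2 ^ d))%N.
    by rewrite -[8%N]/(4 * 2)%N expnMn; lia.
  by rewrite ltn_pmul2r // muln_gt0 !expn_gt0.
have [S' [S'S cS' /shattersP shA]] := exists_shattered AS ltA.
(* The default [set0] is never reached for [z] inside [S'], because [A] shatters [S']. *)
pose ext z := odflt set0 [pick x in A | x :&: S' == z].
have extP z : z \subset S' -> ext z \in A /\ ext z :&: S' = z.
  move=> zS; rewrite /ext; case: pickP => [x /andP[xA /eqP]//|no].
  by have [x xA xz] := shA z zS; have := no x; rewrite xA xz eqxx.
pose U := S :\: S'.
pose P' u z := P (ext z) + inner R U (ext z) u.
pose Q' u w := Q (w :|: u).
pose E' u w z := E (ext z) (w :|: u).
(* [Q'] comes before [P'] because the former receiver now speaks first. *)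
pose pot u := potential kappa S' (E' u) (Q' u) (P' u).
have [u uU potu] := exists_le_average U pot.
have wuS w : w \subset S' -> w :|: u \subset S.
  by move=> wS; rewrite subUset (subset_trans wS S'S) (subset_trans uU) ?subsetDl.
exists S', (fun w z => rest m (w :|: u) (ext z)), (E' u), (Q' u), (P' u).
split=> //.
- exact: (@computable_in_comp _ _ k _ _ {set I} {set I}
    (fun w => w :|: u) ext _ (hrest m)).
- by move=> w z; exact: E0.
- move=> w z wS zS; have [zA ez] := extP z zS.
  rewrite -(Amsg _ zA) -fE => wr; apply: hE; [exact: AS|exact: wuS|].
  suff -> : inner R S (ext z) (w :|: u) + P (ext z) + Q (w :|: u) =
    inner R S' w z + Q' u w + P' u z by [].
  rewrite (inner_split _ _ _ S'S) inner_sym.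
  rewrite (@eq_inner _ _ S' _ _ w z); last 2 first.
  + rewrite setIUl (eqP (_ : u :&: S' == set0)) ?setU0 //.
    by rewrite setI_eq0; move: uU; rewrite subsetD => /andP[].
  + by rewrite ez; apply/esym/setIidPl.
  rewrite (@eq_inner _ _ (S :\: S') _ _ (ext z) u) //; last first.
    rewrite setIUl (eqP (_ : w :&: (S :\: S') == set0)) ?set0U //.
    rewrite setI_eq0; apply/pred0P => i /=; rewrite !inE.
    by apply/negP => /and3P[/(subsetP wS)->].
  by rewrite /P' /Q' /U; ring.
apply: le_trans potu _; rewrite /pot /potential !averageD averageZ.
have avQ : average U (fun v => average S' (fun x => Q' v x ^+ 2)) =
    average S (fun y => Q y ^+ 2).
  by rewrite exchange_average (average_split _ S'S).
(* For random [u] the inner product on [U] has mean zero and variance [#|U|], so the cross term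
   disappears. *)
have avP z : average U (fun v => P' v z ^+ 2) = P (ext z) ^+ 2 + #|U|%:R.
  by rewrite (average_inner U (ext z) (fun v => (P (ext z) + v) ^+ 2)) sign_mean_sqr.
have avE : average U (fun v => average S' (fun x => average S' (E' v x))) =
    average S' (fun z => average S (E (ext z))).
  under eq_average do rewrite exchange_average.
  rewrite exchange_average; apply: eq_average => z _.
  by rewrite exchange_average [RHS](average_split _ S'S).
have avcost : kappa * average U (fun v => average S' (fun x => average S' (E' v x)))
    + average U (fun v => average S' (fun z => P' v z ^+ 2)) <=
    2 * average S cost + #|U|%:R.
  rewrite avE (exchange_average U S'); under [X in _ + X]eq_average do rewrite avP.
  rewrite averageD average_cst addrA lerD2r -averageZ -averageD.
  rewrite -[leRHS](average_cst S'); apply: ler_average => z zS.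
  by apply: Acost; have [] := extP z zS.
have avc : average S cost = kappa * average S (fun x => average S (E x)) +
    average S (fun x => P x ^+ 2) by rewrite averageD averageZ.
have cU : #|U|%:R <= #|S|%:R :> R by rewrite ler_nat subset_leq_card ?subsetDl.
have Q0 : 0 <= average S (fun y => Q y ^+ 2).
  by apply: average_ge0 => y _; rewrite sqr_ge0.
rewrite avQ; rewrite avc in avcost; lra.
Qed.

(** With [k] messages left there are at least [8 ^ k * m] coordinates, so exactly [m] can be kept at
    the end, the number of signs behind the tail at [a]. Adding [n] to the potential absorbs the
    additive loss: the sum at most doubles per round. *)
Lemma round_elimination (a tau : R) m n k S f
    (E : {set I} -> {set I} -> R) P Q :
  0 < a -> 2 * tau <= a -> 0 < sign_tail m a -> (0 < m)%N ->
  (2 * #|Msg| < 4 ^ m)%N ->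
  (k = 0 -> #|S| = m)%N -> (8 ^ k * m <= #|S|)%N -> (#|S| <= n)%N ->
  (forall x y, 0 <= E x y) ->
  (forall x y, x \subset S -> y \subset S ->
     wrong tau (f x y) (inner R S x y + P x + Q y) -> 1 <= E x y) ->
  computable_in Msg k f ->
  a ^+ 2 / 32 <=
    2 ^+ k * (potential (a ^+ 2 / (16 * sign_tail m a)) S E P Q + n%:R).
Proof.
move=> a0 atau p0 m0 Mm.
elim: k S f E P Q => [|k IHk] S f E P Q Sm0 Sm Sn E0 hE hf.
  rewrite expr0 mul1r ler_wpDr // -(Sm0 erefl).
  by apply: zero_round_potential hE hf => //; rewrite Sm0.
have kap0 : 0 <= a ^+ 2 / (16 * sign_tail m a).
  by rewrite divr_ge0 ?sqr_ge0 // mulr_ge0 // ltW.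
have m_le : (m <= 8 ^ k * m)%N by rewrite leq_pmull // expn_gt0.
have [||S' [f' [E' [P' [Q' [cS' hf' E'0 hE' pot]]]]]] :=
  @elimination_step _ tau k (8 ^ k * m) S f E P Q kap0 _ _ E0 hE hf.
- by rewrite mulnA -expnS.
- by apply: leq_trans Mm _; rewrite leq_exp2l.
have S'n : (#|S'| <= n)%N by apply: leq_trans Sn; move: Sm; rewrite cS' expnS; lia.
apply: le_trans (IHk S' f' E' P' Q' _ _ S'n E'0 hE' hf') _.
- by rewrite cS' => ->; rewrite mul1n.
- by rewrite cS'.
rewrite [2 ^+ k.+1]exprSr -mulrA ler_pM2l ?exp2_gt0 //.
by have : #|S|%:R <= n%:R :> R by [rewrite ler_nat]; lra.
Qed.

End RoundElimination.

(** * A lower bound on the average error *)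

Section FiniteBound.
Variable R : rcfType.

(* The constants: [q] blocks of [b] signs give a sum of [q * sqrt b / 2] with
   probability [16^-q], and this sum dominates the accumulated noise. *)
Lemma average_error_lower_bound (c : R) (K n k : nat) (Msg : finType)
    (f : {set 'I_n} -> {set 'I_n} -> bool) (E : {set 'I_n} -> {set 'I_n} -> R) :
  let q := (8 * K * 16 ^ k)%N in let b := (n %/ (8 ^ k * q))%N in
  0 < c -> (64 <= K)%N -> 16 * c ^+ 2 <= K%:R -> (0 < k)%N -> (0 < b)%N ->
  (2 * #|Msg| < 4 ^ (q * b))%N ->
  (forall x y, 0 <= E x y) ->
  (forall x y, wrong (2 * c * Num.sqrt n%:R) (f x y) (inner R [set: 'I_n] x y) ->
     1 <= E x y) ->
  computable_in Msg k f ->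
  (1 / 16) ^+ q <=
    4 * 2 ^+ k * average [set: 'I_n] (fun x => average [set: 'I_n] (E x)).
Proof.
move=> q b c0 K64 Kc k0 b0 Mlt E0 hE hf.
have b0R : 0 < b%:R :> R by rewrite ltr0n.
have q0 : (0 < q)%N by rewrite !muln_gt0 expn_gt0; lia.
have q0R : 0 < q%:R :> R by rewrite ltr0n.
pose a : R := q%:R * (Num.sqrt b%:R / 2).
have sb : Num.sqrt b%:R ^+ 2 = b%:R :> R by rewrite sqr_sqrtr ?ler0n.
have a0 : 0 < a by rewrite mulr_gt0 // divr_gt0 // sqrtr_gt0.
have aE : a ^+ 2 = q%:R ^+ 2 * b%:R / 4 by rewrite -sb /a; field.
have le_n : (8 ^ k * q * b <= n)%N by rewrite mulnC leq_trunc_div.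
(* As [b] is positive, rounding down in its definition loses at most a factor two. *)
have n_le : (n <= 2 * (8 ^ k * q * b))%N.
  have D0 : (0 < 8 ^ k * q)%N by rewrite muln_gt0 expn_gt0.
  have := ltn_ceil n D0; rewrite -/b.
  by move: (8 ^ k * q)%N D0 b0 => D; nia.
(* The factor [16 ^ k] in [q] pays twice: [8 ^ k] for the discarded coordinates and [2 ^ k] for the
   growth of the potential. *)
have an : K%:R * 2 ^+ k * n%:R <= a ^+ 2.
  rewrite aE ler_pdivlMr // -!natrX -!natrM ler_nat.
  have -> : (q ^ 2 * b = K * 2 ^ k * (2 * (8 ^ k * q * b)) * 4)%N.
    rewrite -mulnn {1}/q -[16%N]/(2 * 8)%N expnMn; lia.
  by rewrite leq_mul2r leq_mul2l n_le !orbT.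
have ptail : (1 / 16) ^+ q <= sign_tail (q * b) a.
  by apply: sign_tail_blocks => //; [rewrite divr_ge0 ?sqrtr_ge0|rewrite exprMn sb; lra].
have p0 : 0 < sign_tail (q * b) a by apply: lt_le_trans ptail; rewrite exprn_gt0 ?divr_gt0.
have k2 : 1 <= 2 ^+ k :> R by rewrite exprn_ege1 // ler1n.
have n0 : 0 <= n%:R :> R by rewrite ler0n.
have sn : Num.sqrt n%:R ^+ 2 = n%:R :> R by rewrite sqr_sqrtr.
have tau_a : 2 * (2 * c * Num.sqrt n%:R) <= a.
  rewrite -ler_sqr ?nnegrE ?(ltW a0) ?mulr_ge0 ?sqrtr_ge0 ?(ltW c0) //.
  apply: le_trans an; rewrite !exprMn sn.
  have h1 : 16 * c ^+ 2 * n%:R <= K%:R * n%:R by rewrite ler_wpM2r.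
  have h2 : K%:R * n%:R <= K%:R * 2 ^+ k * n%:R :> R.
    by rewrite ler_wpM2r // ler_peMr.
  lra.
have := @round_elimination R _ Msg a _ (q * b) n k [set: 'I_n] f E (fun=> 0) (fun=> 0)
  a0 tau_a p0 _ Mlt _ _ _ E0 _ hf.
rewrite cardsT card_ord muln_gt0 q0 b0 /potential !expr0n /= !average_cst !addr0.
move=> /(_ isT _ _ (leqnn _)) main.
have {}main : a ^+ 2 / 32 <=
    2 ^+ k * (a ^+ 2 / (16 * sign_tail (q * b) a) *
      average [set: 'I_n] (fun x => average [set: 'I_n] (E x)) + n%:R).
  apply: main => [k00||x y _ _]; first by rewrite k00 in k0.
    by rewrite mulnA.
  by rewrite !addr0; apply: hE.
apply: le_trans ptail _; move: main an p0.
set p := sign_tail _ _; set e := average _ _ => main an p0.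
have K64R : 64 <= K%:R :> R by rewrite ler_nat.
(* Since [K] is at least 64, the accumulated noise takes at most half of [a ^+ 2 / 32]; the other
   half must come from errors. *)
have h : 64 * (2 ^+ k * n%:R) <= a ^+ 2.
  by apply: le_trans an; rewrite -mulrA ler_wpM2r // mulr_ge0 // exprn_ge0.
have {}main : a ^+ 2 / 64 <= 2 ^+ k * (a ^+ 2 / (16 * p) * e) by lra.
have ap0 : 0 < a ^+ 2 / (64 * p).
  by rewrite divr_gt0 ?(exprn_gt0 _ a0) // mulr_gt0.
rewrite -(ler_pM2l ap0).
have -> : a ^+ 2 / (64 * p) * p = a ^+ 2 / 64 by field; rewrite gt_eqF.
suff -> : a ^+ 2 / (64 * p) * (4 * 2 ^+ k * e) = 2 ^+ k * (a ^+ 2 / (16 * p) * e) by [].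
by field; rewrite gt_eqF.
Qed.

End FiniteBound.

From mathcomp Require Import all_classical all_reals all_analysis.
From mathcomp Require Import measurable_realfun.
Local Open Scope classical_set_scope.

(** * Fixing the coins and reducing the error *)

Section Amplification.
Variables (R : realType) (d : measure_display) (T : measurableType d).
Variables (mu : probability T R) (X : finType).

(** The sum depends on [r] only through the finite set of [x] with [A x r], so its minimum over [r]
    is attained, and a minimum is at most the mean. *)
Lemma exists_le_mean (A : X -> T -> bool) (w : X -> R) (theta : R) :
  (forall x, measurable [set r | A x r]) -> (forall x, 0 <= w x) ->
  (forall x, (mu [set r | A x r] <= theta%:E)%E) ->
  exists r, \sum_x w x * (A x r)%:R <= theta * \sum_x w x.
Proof.
move=> mA w0 muA.
have inE_set x r : (r \in [set s | A x s]) = A x r.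
  by apply/idP/idP => [/set_mem|/mem_set].
pose g r := \sum_x w x * (A x r)%:R.
have [r gmin] : exists r, forall r', g r <= g r'.
  pose val (B : {set X}) := \sum_x w x * (x \in B)%:R.
  pose B r : {set X} := [set x | A x r]%SET.
  have gE r : g r = val (B r) by apply: eq_bigr => x _; rewrite inE.
  pose Pr (D : {set X}) := `[< exists r, D = B r >].
  (* A space of total mass one has a point. *)
  have [r0 _] : exists r : T, True.
    apply: contrapT => no; have := probability_setT mu.
    have -> : [set: T] = set0 by rewrite -subset0 => r _; apply: no; exists r.
    by rewrite measure0 => /eqP; rewrite eqe eq_sym oner_eq0.
  have P0 : Pr (B r0) by apply/asboolP; exists r0.
  case: (arg_minP val P0) => D /asboolP[r ->] Dmin.
  by exists r => r'; rewrite !gE; apply: Dmin; apply/asboolP; exists r'.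
exists r; rewrite -lee_fin -/(g r).
have m1 x : measurable_fun setT (fun r' => (\1_[set s | A x s] r' : R)).
  exact: measurable_indic.
have gm : (\int[mu]_r' (g r')%:E = \sum_x (w x)%:E * mu [set s | A x s])%E.
  have -> : (fun r' => (g r')%:E) =
      (fun r' => \sum_x (w x)%:E * (\1_[set s | A x s] r')%:E)%E.
    apply/funext => r'; rewrite /g -sumEFin; apply: eq_bigr => x _.
    by rewrite EFinM indicE; congr (_ * _%:R%:E)%E; rewrite inE_set.
  rewrite ge0_integral_sum //; last 2 first.
  - by move=> x; apply: measurable_funeM; exact/measurable_EFinP.
  - by move=> x r' _; rewrite mule_ge0 ?lee_fin.
  apply: eq_bigr => x _; rewrite ge0_integralZl_EFin //.
  - by rewrite integral_indic // setIT.
  - exact/measurable_EFinP.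
have : ((g r)%:E <= \int[mu]_r' (g r')%:E)%E.
  have -> : (g r)%:E = (\int[mu]_r' (cst (g r)%:E) r')%E.
    rewrite (integral_cst mu measurableT) [X in (_ * X)%E](_ : _ = 1%E) ?mule1 //.
    exact: probability_setT.
  have g0 r' : 0 <= g r' by apply: sumr_ge0 => x _; rewrite mulr_ge0.
  apply: ge0_le_integral => //= [r' _||r' _].
  - by rewrite lee_fin.
  - apply/measurable_EFinP.
    have -> : g = (fun r' => \sum_x w x * \1_[set s | A x s] r').
      apply/funext => r'; apply: eq_bigr => x _.
      by rewrite indicE; congr (_ * _%:R); rewrite inE_set.
    by apply: measurable_sum => x; apply: measurable_funM.
  - by rewrite lee_fin.
move=> /le_trans; apply; rewrite gm mulr_sumr -sumEFin; apply: lee_sum => x _.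
by rewrite EFinM muleC lee_wpmul2r ?lee_fin.
Qed.

(* Choosing the coins one by one so that [\sum_x 2 ^ (number of errors on x)]
   never exceeds its mean replaces independence and a Chernoff bound. *)
Lemma exists_good_coins (A : X -> T -> bool) (t : nat) :
  (forall x, measurable [set r | A x r]) ->
  (forall x, (mu [set r | A x r] <= (1 / 3)%:E)%E) ->
  exists rs : t.-tuple T,
    \sum_x 2 ^+ count (A x) rs <= (4 / 3) ^+ t * #|X|%:R :> R.
Proof.
move=> mA muA; elim: t => [|t [rs IH]].
  by exists [tuple]; rewrite /= expr0 mul1r sumr_const.
have [r hr] := @exists_le_mean A (fun x => 2 ^+ count (A x) rs) (1 / 3) mA
  (fun=> exprn_ge0 _ (ler0n _ _)) muA.
exists [tuple of r :: rs] => /=.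
(* A new repetition doubles the weight of the inputs it errs on, at most a third of the total
   weight; hence the factor [4 / 3]. *)
have -> : \sum_x 2 ^+ (A x r + count (A x) rs) =
    \sum_x 2 ^+ count (A x) rs + \sum_x 2 ^+ count (A x) rs * (A x r)%:R :> R.
  rewrite -big_split /=; apply: eq_bigr => x _; rewrite exprD.
  by case: (A x r) => /=; rewrite ?expr1 ?expr0; ring.
rewrite exprS -mulrA; move: hr IH.
move: (_ ^+ t * _) (\sum_x 2 ^+ count _ _) (\sum_x _ * _) => Z W V; lra.
Qed.

(** Exponential Markov inequality: [j] errors weigh at least [2 ^+ j], and
    [(4 / 3) ^+ 2 / 2 = 8 / 9]. *)
Lemma majority_error (A : X -> T -> bool) (j : nat) (rs : (j + j).-tuple T) :
  \sum_x 2 ^+ count (A x) rs <= (4 / 3) ^+ (j + j) * #|X|%:R :> R ->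
  \sum_x (j <= count (A x) rs)%:R <= (8 / 9) ^+ j * #|X|%:R :> R.
Proof.
move=> h; rewrite -(@ler_pM2l _ (2 ^+ j)) ?exprn_gt0 //.
have -> : 2 ^+ j * ((8 / 9) ^+ j * #|X|%:R) = (4 / 3) ^+ (j + j) * #|X|%:R :> R.
  by rewrite exprD mulrA -!exprMn; congr (_ ^+ j * _); field.
apply: le_trans h; rewrite mulr_sumr; apply: ler_sum => x _.
have [jc|_] := leqP j (count (A x) rs).
  by rewrite mulr1 ler_weXn2l // ler1n.
by rewrite mulr0 exprn_ge0.
Qed.

End Amplification.

(** * Postprocessing and parallel repetition *)

Lemma computable_in_post (Msg Out Out' X Y : Type) k (f : X -> Y -> Out)
    (g : Out -> Out') :
  computable_in Msg k f -> computable_in Msg k (fun x y => g (f x y)).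
Proof.
elim: k X Y f => [|k IHk] X Y f /=.
  by move=> [h fh]; exists (g \o h) => x y; rewrite fh.
move=> [msg [rest [hr fE]]]; exists msg, (fun m y x => g (rest m y x)).
by split=> [m|x y]; [apply: IHk|rewrite fE].
Qed.

(** The copies run in parallel and their simultaneous messages are bundled into one, so the number
    of rounds is unchanged. *)
Lemma computable_in_ffun (Msg Out X Y : Type) t k (f : 'I_t -> X -> Y -> Out) :
  (forall i, computable_in Msg k (f i)) ->
  computable_in {ffun 'I_t -> Msg} k (fun x y => [ffun i => f i x y]).
Proof.
elim: k X Y f => [|k IHk] X Y f /=.
  move=> /choice[g fg]; exists (fun x => [ffun i => g i x]) => x y.
  by apply/ffunP => i; rewrite !ffunE fg.
move=> /choice[msg /choice[rest hr]].
exists (fun x => [ffun i => msg i x]), (fun m y x => [ffun i => rest i (m i) y x]).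
split=> [m|x y]; first by apply: IHk => i; have [] := hr i.
by apply/ffunP => i; rewrite !ffunE; have [_ ->] := hr i.
Qed.

(** * From transcripts to nested functions *)

Section FromProtocols.
Variables n s : nat.
Implicit Types (D : det_protocol n s) (x y : bits n).

(** The last [k] rounds after history [h]; the inputs trade places at each message, so that [x]
    always belongs to the next speaker, as in [computable_in]. *)
Fixpoint play D k i (h : seq (bits s)) x y : bool :=
  if k is k'.+1 then play D k' i.+1 (rcons h (next_msg D i x h)) y x
  else announce D x h.

Lemma play_computable D k i h : computable_in (bits s) k (play D k i h).
Proof.
elim: k i h => [|k IHk] i h /=; first by exists (announce D ^~ h).
exists (fun x => next_msg D i x h), (fun m => play D k i.+1 (rcons h m)).
by split.
Qed.

Lemma play_output D k i x y :
  play D k i (transcript D x y i) (speaker_input x y i) (speaker_input x y i.+1)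
  = output (i + k) D x y.
Proof.
elim: k i => [|k IHk] i; first by rewrite addn0.
rewrite addnS -addSn -IHk /=; congr play.
by rewrite /speaker_input /= negbK.
Qed.

Lemma output_computable D k : computable_in (bits s) k (output k D).
Proof.
have -> : output k D = play D k 0 [::].
  by apply/funext => x; apply/funext => y; rewrite (play_output D k 0 x y).
exact: play_computable.
Qed.

End FromProtocols.

(** * Application to Gap-Hamming-Distance *)

Section GapHamming.
Variable R : realType.

Definition bits_of n (x : {set 'I_n}) : bits n := [tuple i \in x | i < n].

Lemma inner_hamming n (x y : {set 'I_n}) :
  inner R [set: 'I_n]%SET x y =
  n%:R - 2 * (hamming (bits_of x) (bits_of y))%:R.
Proof.
pose F (i : 'I_n) : R := ((i \in x) (+) (i \in y))%:R.
have -> : (hamming (bits_of x) (bits_of y))%:R = \sum_i F i.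
  rewrite /hamming -sum1_card natr_sum big_mkcond /=; apply: eq_bigr => i _.
  rewrite /F inE !tnth_mktuple.
  by case: (i \in x); case: (i \in y).
rewrite mulr_sumr -sumrN -[n in n%:R]card_ord -sum1_card natr_sum -big_split /=.
rewrite /inner; apply: eq_big => [i|i _]; first by rewrite finset.in_setT.
by rewrite /F; case: (_ (+) _) => /=; rewrite ?expr0 ?expr1; lra.
Qed.

Lemma ghd_small (c : R) n (x y : bits n) : 0 < c -> (0 < n)%N ->
  2 * c * Num.sqrt n%:R <= n%:R - 2 * (hamming x y)%:R -> ghd c x y = Some false.
Proof.
move=> c0 n0 h; have cn : 0 < c * Num.sqrt n%:R.
  by rewrite mulr_gt0 // sqrtr_gt0 ltr0n.
rewrite /ghd; have [h1|_] := leP (n%:R / 2 + _) _; first by exfalso; lra.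
by have [//|h2] := leP (hamming x y)%:R _; exfalso; lra.
Qed.

Lemma ghd_large (c : R) n (x y : bits n) :
  n%:R - 2 * (hamming x y)%:R <= - (2 * c * Num.sqrt n%:R) ->
  ghd c x y = Some true.
Proof.
by move=> h; rewrite /ghd; have [//|h1] := leP (n%:R / 2 + _) _; exfalso; lra.
Qed.

Lemma count_tnth t (T : Type) (a : pred T) (rs : t.-tuple T) :
  count a rs = #|[pred i | a (tnth rs i)]|.
Proof. by rewrite -sum1_count big_tuple -sum1_card. Qed.

Section Protocol.
Variables (d : measure_display) (T : measurableType d) (n k s : nat).
Variables (mu : probability T R) (P : protocol T n k s).

Lemma measurable_error (x y : bits n) (v : option bool) :
  measurable [set r | ~~ matches (output k (run_with P r) x y) v].
Proof.
have mP := measurable_output P x y.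
case: v => [[]|] /=.
- have -> : [set r | output k (run_with P r) x y != true] =
      ~` [set r | output k (run_with P r) x y].
    by apply/seteqP; split=> r /=; case: output.
  exact: measurableC.
- have -> : [set r | output k (run_with P r) x y != false] =
      [set r | output k (run_with P r) x y].
    by apply/seteqP; split=> r /=; case: output.
  exact: mP.
- by rewrite (_ : [set _ | _] = set0) //; apply/seteqP; split.
Qed.

Lemma exists_majority_protocol (c : R) (j : nat) : 0 < c -> (0 < n)%N ->
  ghd_error_le mu P c (1 / 3) ->
  exists (f : {set 'I_n} -> {set 'I_n} -> bool)
         (E : {set 'I_n} -> {set 'I_n} -> R),
    [/\ computable_in {ffun 'I_(j + j) -> bits s} k f,
      forall x y, 0 <= E x y,
      forall x y, wrong (2 * c * Num.sqrt n%:R) (f x y)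
        (inner R [set: 'I_n]%SET x y) -> 1 <= E x y &
      average [set: 'I_n]%SET (fun x => average [set: 'I_n]%SET (E x))
        <= (8 / 9) ^+ j].
Proof.
move=> c0 n0 err.
pose X : finType := ({set 'I_n} * {set 'I_n})%type.
pose A (p : X) (r : T) :=
  ~~ matches (output k (run_with P r) (bits_of p.1) (bits_of p.2))
             (ghd c (bits_of p.1) (bits_of p.2)).
have [rs /majority_error hrs] := @exists_good_coins _ _ _ mu X A (j + j)
  (fun p => measurable_error _ _ _) (fun p => err _ _).
pose out i (x y : {set 'I_n}) :=
  output k (run_with P (tnth rs i)) (bits_of x) (bits_of y).
(* A tie is answered [false]. This is harmless, as the error below already counts inputs on which
   exactly half of the repetitions err. *)
pose maj (o : {ffun 'I_(j + j) -> bool}) := (j < #|[pred i | o i]|)%N.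
exists (fun x y => maj [ffun i => out i x y]),
       (fun x y => (j <= count (A (x, y)) rs)%:R).
split=> [||x y|].
- apply: computable_in_post; apply: computable_in_ffun => i.
  exact: (computable_in_comp (@bits_of n) (@bits_of n) (output_computable _ _)).
- by move=> x y; rewrite ler0n.
- have cE : #|[pred i | [ffun i => out i x y] i]| = #|[pred i | out i x y]|.
    by apply: eq_card => i; rewrite !inE ffunE.
  rewrite /wrong /maj cE inner_hamming count_tnth.
  have [lt_j h|le_j h] := ltnP j #|[pred i | out i x y]|; rewrite ler1n lt0b.
    apply: leq_trans (ltnW lt_j) _; apply/eq_leq/eq_card => i.
    by rewrite !inE /A ghd_small //= /out; case: output.
  rewrite -(leq_add2l #|[pred i | out i x y]|).
  have -> : #|[pred i | A (x, y) (tnth rs i)]| = #|[predC [pred i | out i x y]]|.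
    by apply: eq_card => i; rewrite !inE /A ghd_large //= /out; case: output.
  by rewrite cardC card_ord leq_add2r.
- rewrite /average !cardsT card_ord.
  have powT : forall g : {set 'I_n} -> R,
      \sum_(x in powerset [set: 'I_n]%SET) g x = \sum_x g x.
    by move=> g; apply: eq_bigl => x; rewrite inE finset.subsetT.
  rewrite powT; under eq_bigr do rewrite powT.
  rewrite -mulr_suml -mulrA -invfM pair_big /=.
  have cX : #|X|%:R = 2 ^+ n * 2 ^+ n :> R.
    rewrite card_prod -cardsT -powersetT card_powerset cardsT card_ord.
    by rewrite natrM natrX.
  rewrite ler_pdivrMr ?mulr_gt0 ?exprn_gt0 // -cX.
  by apply: le_trans hrs; apply: ler_sum => -[x y] _.
Qed.

(** Amplification to error about [16 ^ -q] multiplies the message length by [O(q)]. The lower bound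
    on the error then forces this length to be at least of order [q * b], so [s] is at least of
    order [b]. *)
Lemma message_length_bound (c : R) (K : nat) : 0 < c -> (64 <= K)%N ->
  16 * c ^+ 2 <= K%:R -> (0 < n)%N -> (0 < k)%N -> (0 < s)%N ->
  ghd_error_le mu P c (1 / 3) -> (n <= 1536 * K * 128 ^ k * s)%N.
Proof.
move=> c0 K64 Kc n0 k0 s0 err.
pose q := (8 * K * 16 ^ k)%N; pose b := (n %/ (8 ^ k * q))%N.
have q0 : (0 < q)%N by rewrite !muln_gt0 expn_gt0; lia.
have D0 : (0 < 8 ^ k * q)%N by rewrite muln_gt0 expn_gt0.
have boundE : (1536 * K * 128 ^ k * s = 192 * (8 ^ k * q) * s)%N.
  by rewrite /q -[128%N]/(8 * 16)%N expnMn; lia.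
have nlt : (n < b.+1 * (8 ^ k * q))%N := ltn_ceil n D0.
(* When [b = 0], [n] is below [8 ^ k * q] and one bit per message is enough. *)
rewrite boundE; have [b0|b0] := posnP b.
  by move: nlt; rewrite b0; move: (8 ^ k * q)%N => D; nia.
(* Since [(8 / 9) ^+ 6 <= 1 / 2], the error is at most [16 ^ -q / (8 * 2 ^ k)], half of what the
   lower bound allows. *)
pose j := (6 * (4 * q + 3 + k))%N.
have [f [E [hf E0 hE avE]]] := exists_majority_protocol j c0 n0 err.
have [lt_msg|ge_msg] :=
    ltnP (2 * #|{ffun 'I_(j + j) -> bits s}|) (4 ^ (q * b)).
  have := average_error_lower_bound c0 K64 Kc k0 b0 lt_msg E0 hE hf.
  rewrite -/q => low; exfalso.
  have : (8 / 9) ^+ j <= (1 / 2) ^+ (4 * q + 3 + k) :> R.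
    by rewrite /j exprM lerXn2r ?nnegrE ?exprn_ge0 ?divr_ge0 //; lra.
  have e16 : (1 / 2) ^+ 4 = 1 / 16 :> R by field.
  have -> : (1 / 2) ^+ (4 * q + 3 + k) =
      (1 / 16) ^+ q * (1 / 2) ^+ 3 * (1 / 2) ^+ k :> R.
    by rewrite -e16 -exprM -!exprD.
  move=> small.
  have ek : 2 ^+ k * (1 / 2) ^+ k = 1 :> R by rewrite -exprMn mul1r divff ?expr1n.
  have q16 : 0 < (1 / 16) ^+ q :> R by rewrite exprn_gt0 // divr_gt0.
  have : 4 * 2 ^+ k *
      average [set: 'I_n]%SET (fun x => average [set: 'I_n]%SET (E x)) <=
      4 * 2 ^+ k * ((1 / 16) ^+ q * (1 / 2) ^+ 3 * (1 / 2) ^+ k).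
    by rewrite ler_pM2l ?mulr_gt0 ?exprn_gt0 //; apply: le_trans avE _.
  have -> : 4 * 2 ^+ k * ((1 / 16) ^+ q * (1 / 2) ^+ 3 * (1 / 2) ^+ k) =
    4 * (1 / 2) ^+ 3 * (1 / 16) ^+ q * (2 ^+ k * (1 / 2) ^+ k) :> R by ring.
  by rewrite ek; lra.
have {ge_msg}qb : (2 * (q * b) <= s * (j + j) + 1)%N.
  move: ge_msg; rewrite card_ffun card_tuple card_bool card_ord -expnM.
  by rewrite -[4%N]/(2 ^ 2)%N -expnM -expnS leq_exp2l // addn1.
have kq : (3 + k <= 4 * q)%N.
  have := ltn_expl k (isT : (1 < 16)%N); rewrite /q; nia.
have jq : (j + j <= 96 * q)%N by rewrite /j; lia.
have h1 : (2 * (q * b) <= 192 * q * s)%N by nia.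
have h2 : (n <= 8 ^ k * (2 * (q * b)))%N.
  move: nlt b0; rewrite mulSn => nlt b0; move: nlt.
  by move: (8 ^ k)%N => D; nia.
have := leq_mul (leqnn (8 ^ k)) h1; move: h2.
by move: (8 ^ k)%N => D; lia.
Qed.

End Protocol.
End GapHamming.

(** * Messages of length zero *)

Section SilentProtocols.
Variable R : realType.

Definition negate n (x : bits n) : bits n := [tuple ~~ tnth x i | i < n].

Lemma hamming_sym n (x y : bits n) : hamming x y = hamming y x.
Proof. by apply: eq_card => i; rewrite !inE eq_sym. Qed.

Lemma hamming_negate n (x y : bits n) :
  (hamming x y + hamming (negate x) y = n)%N.
Proof.
rewrite -[RHS]card_ord -(cardC [pred i | tnth x i != tnth y i]).
congr (_ + _)%N; apply: eq_card => i; rewrite !inE tnth_mktuple.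
by case: (tnth x i); case: (tnth y i).
Qed.

Lemma ghd_sym (c : R) n (x y : bits n) : ghd c x y = ghd c y x.
Proof. by rewrite /ghd hamming_sym. Qed.

Lemma ghd_negate (c : R) n (x y : bits n) b : 0 < c -> (0 < n)%N ->
  ghd c x y = Some b -> ghd c (negate x) y = Some (~~ b).
Proof.
move=> c0 n0; have hn : (hamming x y)%:R + (hamming (negate x) y)%:R = n%:R :> R.
  by rewrite -natrD hamming_negate.
rewrite {1}/ghd; have [h1 [<-]|_] := leP (n%:R / 2 + _) _.
  by apply: ghd_small => //; lra.
have [h2 [<-]|//] := leP (hamming x y)%:R _.
by apply: ghd_large; lra.
Qed.

Lemma transcript_silent n (D : det_protocol n 0) (x y x' y' : bits n) k :
  transcript D x y k = transcript D x' y' k.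
Proof. by elim: k => //= k ->; congr rcons; rewrite [LHS]tuple0 [RHS]tuple0. Qed.

(** Negating one input flips a defined value. If the other player announces, the output does not
    change, so for all coins exactly one of the two inputs is answered wrongly, and two errors of at
    most [1 / 3] cannot add up to one. *)
Lemma silent_protocol_fails (c : R) (d : measure_display)
    (T : measurableType d) (mu : probability T R) n k (P : protocol T n k 0)
    (x y : bits n) :
  0 < c -> (0 < n)%N -> ghd c x y <> None -> ~ ghd_error_le mu P c (1 / 3).
Proof.
move=> c0 n0; case E1 : (ghd c x y) => [v|//] _ err.
(* For odd [k] the announcer holds [y], for even [k] it holds [x]. *)
pose x' := if odd k then negate x else x.
pose y' := if odd k then y else negate y.
have E2 : ghd c x' y' = Some (~~ v).
  rewrite /x' /y'; case: (odd k); first exact: ghd_negate.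
  by rewrite ghd_sym; apply: ghd_negate; rewrite // ghd_sym.
have same r : output k (run_with P r) x y = output k (run_with P r) x' y'.
  rewrite /output (transcript_silent _ x y x' y') /speaker_input /x' /y'.
  by case: (odd k).
pose A (i : bool) (r : T) := if i
  then ~~ matches (output k (run_with P r) x y) (ghd c x y)
  else ~~ matches (output k (run_with P r) x' y') (ghd c x' y').
have [||r] := @exists_le_mean _ _ _ mu bool A (fun=> 1) (1 / 3) _ (fun=> ler01).
- by case; apply: measurable_error.
- by case; apply: err.
rewrite !big_bool /A E1 E2 /= -same; case: output; case: (v) => /=; lra.
Qed.

End SilentProtocols.

(** * Constants and conclusion *)

Lemma ghd_message_bound (R : realType) (c : R) : 0 < c ->
  exists2 C : R, 0 < C &
    forall (n k s : nat) (d : measure_display) (T : measurableType d)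
      (mu : probability T R) (P : protocol T n k s),
      (1 <= n)%N -> (1 <= k)%N ->
      (1 <= s)%N \/ (exists x y : bits n, ghd c x y <> None) ->
      ghd_error_le mu P c (1 / 3) ->
      n%:R / 2 `^ (C * k%:R ^+ 2) <= s%:R.
Proof.
move=> c0; pose K := (64 + Num.trunc (16 * c ^+ 2))%N.+1.
have Kc : 16 * c ^+ 2 <= K%:R.
  apply: le_trans (ltW (truncnS_gt _)) _.
  by rewrite ler_nat /K ltnS leq_addl.
pose L := (1536 * K * 128)%N.
exists L%:R; first by rewrite ltr0n /L /K; lia.
move=> n k s d T mu P n0 k0 hs err.
have s0 : (0 < s)%N.
  case: hs => // -[x [y xy]]; rewrite lt0n; apply/eqP => s0; subst s.
  exact: silent_protocol_fails xy err.
rewrite -natrX -natrM powR_mulrn // ler_pdivrMr ?exprn_gt0 // -natrX -natrM ler_nat.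
apply: leq_trans (message_length_bound c0 _ Kc n0 k0 s0 err) _; first by rewrite /K; lia.
rewrite mulnC leq_mul2l; apply/orP; right.
(* The exponent obtained is linear in [k]: the factor is at most [L ^ k], hence at most
   [2 ^ (L * k)], which is weakened to [2 ^ (L * k ^ 2)]. *)
apply: (@leq_trans (L ^ k)).
  case: k k0 {P err} => // k _; rewrite /L expnMn leq_mul2r; apply/orP; right.
  by rewrite -[leqLHS]expn1 leq_pexp2l //; rewrite /K; lia.
apply: (@leq_trans ((2 ^ L) ^ k)); first by apply/leq_expr/ltnW/ltn_expl.
by rewrite -expnM leq_exp2l // leq_mul2l -mulnn leq_pmulr ?orbT.
Qed.

Theorem theorem1 (R : realType) (c : R) (c_gt0 : 0 < c) :
  (exists2 C : R, 0 < C &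
    forall (n k s : nat) (d : measure_display) (T : measurableType d)
      (mu : probability T R) (P : protocol T n k s),
      (1 <= n)%N -> (1 <= k)%N ->
      (1 <= s)%N \/ (exists x y : bits n, ghd c x y <> None) ->
      ghd_error_le mu P c (1 / 3) ->
      n%:R / 2 `^ (C * k%:R ^+ 2) <= s%:R)
  /\
  (forall k : nat, (1 <= k)%N ->
    exists2 delta : R, 0 < delta &
      forall (n s : nat) (d : measure_display) (T : measurableType d)
        (mu : probability T R) (P : protocol T n k s),
        (1 <= n)%N ->
        (1 <= s)%N \/ (exists x y : bits n, ghd c x y <> None) ->
        ghd_error_le mu P c (1 / 3) ->
        delta * n%:R <= s%:R).
Proof.
have [C C0 bound] := ghd_message_bound c_gt0.
split; first by exists C.
move=> k k0; exists (2 `^ (C * k%:R ^+ 2))^-1; first by rewrite invr_gt0 powR_gt0.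
by move=> n s d T mu P n0 hs err; rewrite mulrC; apply: bound err.
Qed.
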